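(* Let $\rho$ be a regular mass distribution of total mass $M>0$. If $\rho$ is totally dispersive or partially dispersive, then it is statistically dispersive. In particular, if $\rho$ is totally dispersive, then \[ \lim_{t\to\infty}\langle(\Delta x)^2\rangle(t)=+\infty . \]
   Context: A regular mass distribution of total mass $M$ is a non-negative $C^1$ function $\rho(t,x)$ ($t\in\mathbb{R}$, $x\in\mathbb{R}^3$) such that $\rho(t,\cdot)$ has compact support for each $t$ and $\|\rho(t)\|_{L^1(\mathbb{R}^3)}=M$, independent of $t$. $\rho$ is totally (respectively partially) dispersive if for every $R>0$ the limit \[ \mathcal{M}(R)=\lim_{t\to\infty}\sup_{x_0\in\mathbb{R}^3}\int_{|x-x_0|<R}\rho(t,x)\,dx \] exists and $\mathcal{M}_\infty=\lim_{R\to\infty}\mathcal{M}(R)$ satisfies $\mathcal{M}_\infty=0$ (respectively $\mathcal{M}_\infty\in(0,M)$). The statistical dispersion is \[ \langle(\Delta x)^2\rangle(t)=\frac1M\left[\int_{\mathbb{R}^3}|x|^2\rho(t,x)\,dx-\frac1M\left|\int_{\mathbb{R}^3}x\,\rho(t,x)\,dx\right|^2\right], \] and $\rho$ is statistically dispersive if $\sup_{t>0}\langle(\Delta x)^2\rangle(t)=+\infty$. *)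

(* Defs.v *)
From HB Require Import structures.
From mathcomp Require Import all_boot all_order all_algebra.
From mathcomp Require Import all_classical all_reals all_analysis.

Set Implicit Arguments.
Unset Strict Implicit.
Unset Printing Implicit Defensive.

Import Order.TTheory GRing.Theory Num.Theory.
Import numFieldNormedType.Exports.

Local Open Scope classical_set_scope.
Local Open Scope ring_scope.

(* The library norm on a product is the sup norm, so |x| on R^3 is defined here;
   both induce the product topology. *)
Definition enorm (R : realType) (x : R * R * R) : R :=
  Num.sqrt (x.1.1 ^+ 2 + x.1.2 ^+ 2 + x.2 ^+ 2).

Definition eball (R : realType) (x0 : R * R * R) (r : R) : set (R * R * R) :=
  [set x | enorm (x - x0) < r].

Definition lebesgue3 (R : realType) :
    set (measurableTypeR R * measurableTypeR R * measurableTypeR R)%type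
    -> \bar R :=
  ((@lebesgue_measure R \x @lebesgue_measure R) \x @lebesgue_measure R)%E.

HB.instance Definition _ (R : realType) :=
  Measure.on (@lebesgue3 R).

(* In finite dimension, pointwise continuity of the differential (i.e. of every
   directional derivative) is its continuity in operator norm. *)
Definition C1 (R : realType) (V : normedModType R) (f : V -> R) : Prop :=
  (forall p, differentiable f p) /\ (forall v, continuous ('D_v f)).

Record regular_mass_distribution (R : realType) (M : R)
    (rho : R -> R * R * R -> R) : Prop := RegularMassDistribution {
  rmd_ge0 : forall t x, 0 <= rho t x ;
  rmd_C1 : C1 (fun p : R * (R * R * R) => rho p.1 p.2) ;
  rmd_compact_support : forall t, compact (closure [set x | rho t x != 0]) ;
  rmd_mass : forall t, ('N[@lebesgue3 R]_1[EFin \o rho t] = M%:E)%E }.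

Definition concentration (R : realType) (rho : R -> R * R * R -> R) (r t : R)
    : \bar R :=
  ereal_sup [set (\int[@lebesgue3 R]_(x in eball x0 r) (rho t x)%:E)%E
            | x0 in [set: R * R * R]].

(* [Minf] is the limit, as r tends to infinity, of the limit, as t tends to
   infinity, of [concentration rho r t]; both limits are required to exist. *)
Definition limit_concentration (R : realType) (rho : R -> R * R * R -> R)
    (Minf : \bar R) : Prop :=
  exists2 Mlim : R -> \bar R,
    forall r : R, 0 < r -> concentration rho r t @[t --> +oo] --> Mlim r
  & Mlim r @[r --> +oo] --> Minf.

Definition totally_dispersive (R : realType) (rho : R -> R * R * R -> R) : Prop :=
  limit_concentration rho 0%E.

Definition partially_dispersive (R : realType) (M : R)
    (rho : R -> R * R * R -> R) : Prop :=
  exists2 Minf : \bar R,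
    (0 < Minf < M%:E)%E & limit_concentration rho Minf.

Definition first_moment (R : realType) (f : R * R * R -> R) : R * R * R :=
  (\int[@lebesgue3 R]_x (x.1.1 * f x),
   \int[@lebesgue3 R]_x (x.1.2 * f x),
   \int[@lebesgue3 R]_x (x.2 * f x)).

(* For a regular mass distribution the integrands are continuous with compact
   support, so real-valued integrals lose nothing. *)
Definition statistical_dispersion (R : realType) (M : R)
    (rho : R -> R * R * R -> R) (t : R) : R :=
  M^-1 * (\int[@lebesgue3 R]_x (enorm x ^+ 2 * rho t x)
          - M^-1 * enorm (first_moment (rho t)) ^+ 2).

Definition statistically_dispersive (R : realType) (M : R)
    (rho : R -> R * R * R -> R) : Prop :=
  ereal_sup [set (statistical_dispersion M rho t)%:E | t in [set t | 0 < t]]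
  = +oo%E.

(* Main.v *)
(* Let c be the centre of mass at time t. By Steiner's identity the dispersion
   is 1/M times the integral of |x - c|^2 rho, and on the complement of the ball
   of radius r around c this integrand is at least r^2 rho; hence the dispersion
   is at least r^2 (M - L) / M as soon as every ball of radius r carries mass at
   most L. If the limit concentration is below M, some L < M works for all large
   r and all t large depending on r, so the dispersion tends to infinity, also
   in the partially dispersive case. *)
Require Import Defs.
From HB Require Import structures.
From mathcomp Require Import all_boot all_order all_algebra.
From mathcomp Require Import all_classical all_reals all_analysis.
From mathcomp Require Import measurable_realfun ring lra.

Set Implicit Arguments.
Unset Strict Implicit.
Unset Printing Implicit Defensive.

Import Order.TTheory GRing.Theory Num.Theory.
Import numFieldNormedType.Exports.

Local Open Scope classical_set_scope.
Local Open Scope ring_scope.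

Local Notation space R :=
  (measurableTypeR R * measurableTypeR R * measurableTypeR R)%type.

(** * Measurability and integrability on [R * R * R] *)

Lemma measurable_ball3 (R : realType) (x : R * R * R) (e : R) :
  measurable (ball x e : set (space R)).
Proof.
have -> : ball x e = (ball x.1.1 e `*` ball x.1.2 e) `*` (ball x.2 e).
  by [].
by apply: measurableX; [apply: measurableX|];
  apply: open_measurable; exact: ball_open.
Qed.

(** The sigma-algebra of [space R] is generated by measurable rectangles. An open set is the union
    of the cubes with rational centre and radius that it contains, and there are countably many of
    these. *)
Lemma open_measurable3 (R : realType) (U : set (R * R * R)) :
  open U -> measurable (U : set (space R)).
Proof.
move=> oU.
pose c (q : rat * rat * rat * rat) : R * R * R :=
  (ratr q.1.1.1, ratr q.1.1.2, ratr q.1.2).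
pose B q := ball (c q) (ratr q.2).
have -> : U = \bigcup_(q in [set q | B q `<=` U]) B q.
  apply/seteqP; split=> [x Ux|x [q /= BU /BU //]].
  have /nbhs_ballP[e /= e0 xeU] : nbhs x U by exact: open_nbhs_nbhs.
  have /rat_in_itvoo[r] : 0 < e / 2 by rewrite divr_gt0.
  rewrite in_itv /= => /andP[r0 re].
  have near_rat (y : R) : exists q : rat, ball (ratr q : R) (ratr r) y.
    have /rat_in_itvoo[q] : y - ratr r < y + ratr r by lra.
    rewrite in_itv /= => /andP[yq qy]; exists q.
    by rewrite -ball_normE /= ltr_norml; apply/andP; split; lra.
  have [q1 Hq1] := near_rat x.1.1.
  have [q2 Hq2] := near_rat x.1.2.
  have [q3 Hq3] := near_rat x.2.
  have Bx : B (q1, q2, q3, r) x by [].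
  exists (q1, q2, q3, r) => //= y By; apply: xeU.
  (* Both [x] and [y] lie within [r] of the rational centre, so their distance is below [2 * r < e];
     this is why [r] was taken below [e / 2]. *)
  apply: (@le_ball _ _ _ (ratr r + ratr r)); first lra.
  by apply: (ball_triangle (ball_sym _) By).
rewrite bigcup_mkcond; apply: countable_bigcupT_measurable => // q.
by case: ifP => // _; exact: measurable_ball3.
Qed.

Lemma continuous_measurable_fun3 (R : realType) (f : R * R * R -> R) :
  continuous f -> measurable_fun [set: space R] (f : space R -> R).
Proof.
move=> /continuousP cf; apply: (measurability _ (RGenOpens.measurableE R)).
move=> _ [_ [a [b ->] <-]]; rewrite setTI; apply: open_measurable3.
exact/cf/interval_open.
Qed.

(** On the compact support of [f] the factor [g] is bounded, and elsewhere the product vanishes, so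
    a multiple of [f] dominates it. *)
Lemma integrableMl_continuous (R : realType) (g f : R * R * R -> R) :
  continuous g -> continuous f -> compact (closure [set x | f x != 0]) ->
  (@lebesgue3 R).-integrable setT (EFin \o f) ->
  (@lebesgue3 R).-integrable setT (EFin \o (g \* f)).
Proof.
move=> cg cf kf fi.
have : bounded_set (g @` closure [set x | f x != 0]).
  apply: compact_bounded; apply: continuous_compact => //.
  exact: continuous_subspaceT.
case=> K [_ /(_ (K + 1))]; rewrite ltrDl ltr01 => /(_ isT) gK.
apply: (le_integrable measurableT _ _ (integrableZl measurableT (K + 1) fi)).
  apply/measurable_EFinP; apply: continuous_measurable_fun3 => x.
  exact: continuousM (cg x) (cf x).
move=> x _ /=; rewrite lee_fin.
have [->|fx0] := eqVneq (f x) 0; first by rewrite !mulr0.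
rewrite normrM [leRHS]normrM ler_wpM2r //.
apply: le_trans (ler_norm _); apply: gK; exists x => //.
exact: subset_closure.
Qed.

Lemma enorm_sqr (R : realType) (x : R * R * R) :
  enorm x ^+ 2 = x.1.1 ^+ 2 + x.1.2 ^+ 2 + x.2 ^+ 2.
Proof. by rewrite sqr_sqrtr // !addr_ge0 // sqr_ge0. Qed.

Lemma continuous_coord1 (R : realType) : continuous (fun x : R * R * R => x.1.1).
Proof.
by move=> [[a b] c]; apply: (@continuous_comp _ _ _ fst fst); exact: cvg_fst.
Qed.

Lemma continuous_coord2 (R : realType) : continuous (fun x : R * R * R => x.1.2).
Proof.
by move=> [[a b] c]; apply: (@continuous_comp _ _ _ fst snd);
  [exact: cvg_fst|exact: cvg_snd].
Qed.

Lemma continuous_coord3 (R : realType) : continuous (fun x : R * R * R => x.2).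
Proof. by move=> [[a b] c]; exact: cvg_snd. Qed.

Lemma continuous_sqr (R : realType) (T : topologicalType) (f : T -> R) :
  continuous f -> continuous (fun x => f x ^+ 2).
Proof. by move=> cf x; exact: (continuousM (cf x) (cf x)). Qed.

Lemma continuous_enorm (R : realType) : continuous (@enorm R).
Proof.
move=> x.
have c1 := @continuous_sqr _ _ _ (@continuous_coord1 R) x.
have c2 := @continuous_sqr _ _ _ (@continuous_coord2 R) x.
have c3 := @continuous_sqr _ _ _ (@continuous_coord3 R) x.
exact: (continuous_comp (continuousD (continuousD c1 c2) c3)
  (@sqrt_continuous R _)).
Qed.

Lemma continuous_enormB (R : realType) (c : R * R * R) :
  continuous (fun x : R * R * R => enorm (x - c)).
Proof.
move=> x; have cB : continuous (fun y : R * R * R => y - c).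
  by move=> y; apply: cvgB; [exact: cvg_id|exact: cvg_cst].
exact: (continuous_comp (cB x) (@continuous_enorm R _)).
Qed.

Lemma measurable_eball (R : realType) (x0 : R * R * R) (r : R) :
  measurable (eball x0 r : set (space R)).
Proof.
apply: open_measurable3.
have -> : eball x0 r = (fun x => enorm (x - x0)) @^-1` [set y | y < r] by [].
apply: open_comp; last exact: open_lt.
by move=> x _; exact: continuous_enormB.
Qed.

(** * Mass and second moments of the density at a fixed time *)

Section density.
Context (R : realType) (M : R) (f : R * R * R -> R).
Hypothesis M_gt0 : 0 < M.
Hypothesis f_ge0 : forall x, 0 <= f x.
Hypothesis f_cont : continuous f.
Hypothesis f_supp : compact (closure [set x | f x != 0]).
Hypothesis f_mass : ('N[@lebesgue3 R]_1[EFin \o f] = M%:E)%E.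

Let mu := @lebesgue3 R.

Lemma integral_density : (\int[mu]_x (f x)%:E = M%:E)%E.
Proof.
rewrite -f_mass Lnorm1; apply: eq_integral => x _ /=.
by rewrite ger0_norm.
Qed.

Lemma integrable_density : mu.-integrable setT (EFin \o f).
Proof.
apply/integrableP; split.
  by apply/measurable_EFinP; exact: continuous_measurable_fun3.
under eq_integral => x _ do rewrite /= ger0_norm //.
by rewrite integral_density ltry.
Qed.

Let P := first_moment f.
Let center : R * R * R := (M^-1 * P.1.1, M^-1 * P.1.2, M^-1 * P.2).

(** Expand the square and integrate term by term. Since the first moment [P] is [M] times [center],
    the cross term gives [-2 |P|^2 / M] and the constant term [|P|^2 / M]. *)
Lemma steiner_identity :
  \int[mu]_x (enorm (x - center) ^+ 2 * f x) =
  \int[mu]_x (enorm x ^+ 2 * f x) - M^-1 * enorm P ^+ 2.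
Proof.
have fi := integrable_density.
have mom (g : R * R * R -> R) : continuous g ->
    mu.-integrable setT (EFin \o (g \* f)).
  by move=> cg; exact: integrableMl_continuous.
have i0 : mu.-integrable setT (EFin \o ((fun x => enorm x ^+ 2) \* f)).
  exact/mom/continuous_sqr/continuous_enorm.
have i1 := mom _ (@continuous_coord1 R).
have i2 := mom _ (@continuous_coord2 R).
have i3 := mom _ (@continuous_coord3 R).
have iZ (k : R) (g : R * R * R -> R) : mu.-integrable setT (EFin \o g) ->
    mu.-integrable setT (EFin \o (fun x => k * g x)).
  by move=> ig; exact: (integrableZl measurableT k ig).
have iB (g h : R * R * R -> R) : mu.-integrable setT (EFin \o g) ->
    mu.-integrable setT (EFin \o h) ->
    mu.-integrable setT (EFin \o (fun x => g x - h x)).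
  by move=> ig ih; exact: (integrableB measurableT ig ih).
under eq_Rintegral => x _.
  (* The constant term carries a double minus sign, so that the integrand is a chain of differences
     and [RintegralB] alone splits it. *)
  have -> : enorm (x - center) ^+ 2 * f x =
    (enorm x ^+ 2 * f x) - (2 * center.1.1) * (x.1.1 * f x)
      - (2 * center.1.2) * (x.1.2 * f x) - (2 * center.2) * (x.2 * f x)
      - (- enorm center ^+ 2) * f x.
    by rewrite !enorm_sqr /=; ring.
  over.
have mass : \int[mu]_x f x = M by rewrite /Rintegral integral_density.
rewrite !RintegralB //; do ?[apply: (iB _ _)|apply: (iZ _ _)] => //.
rewrite !RintegralZl // mass !enorm_sqr /=.
have M0 : M != 0 by rewrite gt_eqF.
by rewrite /center /P /=; field.
Qed.

(* [fine] loses nothing here: the integral is at most [M]. *)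
Lemma le_variance (c : R * R * R) (r : R) : 0 <= r ->
  (r ^+ 2 * (M - fine (\int[mu]_(x in eball c r) (f x)%:E)%E) <=
  \int[mu]_x (enorm (x - c) ^+ 2 * f x)).
Proof.
move=> r0.
have fi := integrable_density.
have gi : mu.-integrable setT
    (EFin \o ((fun x : R * R * R => enorm (x - c) ^+ 2) \* f)).
  apply: integrableMl_continuous => //.
  exact/continuous_sqr/continuous_enormB.
have mB := @measurable_eball R c r.
have mBC := measurableC mB.
have disj : [disjoint eball c r & ~` eball c r].
  by apply/disj_setPS => x [].
have split (g : R * R * R -> R) : mu.-integrable setT (EFin \o g) ->
    \int[mu]_x g x = \int[mu]_(x in eball c r) g x
                     + \int[mu]_(x in ~` eball c r) g x.
  by move=> ig; rewrite -Rintegral_setU // setUv.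
have mass : \int[mu]_x f x = M by rewrite /Rintegral integral_density.
(* With [M] split over the ball and its complement, the left side becomes [r ^+ 2] times the mass
   outside the ball. *)
rewrite -mass (split f fi) (split _ gi).
rewrite -/(Rintegral mu (eball c r) f) addrAC subrr add0r.
have fiC : mu.-integrable (~` eball c r) (EFin \o f).
  exact: (integrableS measurableT).
(* The contribution of the ball to the second moment is nonnegative and is dropped; the integrands
   are then compared on the complement. *)
rewrite -RintegralZl //; apply: ler_wpDl.
  by apply: Rintegral_ge0 => x _; rewrite mulr_ge0 // sqr_ge0.
apply: le_Rintegral => //.
- exact: (integrableZl _ (r ^+ 2) fiC).
- exact: (integrableS measurableT).
move=> x /= /negP; rewrite -leNgt => rx; rewrite ler_wpM2r //.
by rewrite ler_sqr ?nnegrE // (le_trans r0).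
Qed.

End density.

(** * From concentration to dispersion *)

(** The centre of mass may move with [t]; the supremum over all centres in [concentration] bounds
    the mass of the ball around it uniformly. *)
Lemma dispersion_ge (R : realType) (M : R) (rho : R -> R * R * R -> R)
    (t r L : R) :
  0 < M -> regular_mass_distribution M rho -> 0 <= r ->
  (concentration rho r t <= L%:E)%E ->
  M^-1 * (r ^+ 2 * (M - L)) <= statistical_dispersion M rho t.
Proof.
move=> M0 [rho0 [drho _] supp mass] r0 concL.
have cont : continuous (rho t).
  move=> x.
  have c1 : {for x, continuous (fun y : R * R * R => (t, y))}.
    exact: (cvg_pair (cvg_cst t) cvg_id).
  exact: (continuous_comp c1 (differentiable_continuous (drho (t, x)))).
rewrite /statistical_dispersion ler_pM2l ?invr_gt0 //.
rewrite -(steiner_identity M0 (rho0 t) cont (supp t) (mass t)).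
apply: le_trans (le_variance (rho0 t) cont (supp t) (mass t) _ r0).
set c := (X in eball X _).
rewrite ler_wpM2l ?sqr_ge0 // lerD2l lerN2.
have /le_trans /(_ concL) : (\int[@lebesgue3 R]_(x in eball c r) (rho t x)%:E
    <= concentration rho r t)%E.
  by apply: ereal_sup_ubound; exists c.
set I := (\int[_]_(x in _) _)%E => IL.
have I0 : (0 <= I)%E by apply: integral_ge0 => x _; rewrite lee_fin.
by rewrite -lee_fin fineK // ge0_fin_numE // (le_lt_trans IL) ?ltry.
Qed.

Lemma limit_concentration_dispersion (R : realType) (M : R)
    (rho : R -> R * R * R -> R) (Minf : \bar R) :
  0 < M -> regular_mass_distribution M rho ->
  limit_concentration rho Minf -> (0 <= Minf < M%:E)%E ->
  statistical_dispersion M rho t @[t --> +oo] --> +oo.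
Proof.
move=> M0 reg [Mlim limt limr] /andP[Minf0 MinfM].
(* The bounds on [Minf] make it finite, so the midpoint of [Minf] and [M] serves as [L]. *)
have [L ML LM] : exists2 L : R, (Minf < L%:E)%E & L < M.
  case: Minf Minf0 MinfM {limr} => [m|//|//]; rewrite lte_fin => _ mM.
  by exists ((m + M) / 2); rewrite ?lte_fin; lra.
apply/cvgryPge => A.
(* Lying strictly below [L] is an open condition; it passes from [Minf] to [Mlim r] for large [r],
   then to the concentration for large [t]. *)
have lt_near (x : \bar R) : (x < L%:E)%E -> nbhs x [set y | (y < L%:E)%E].
  by move=> xL; apply: open_nbhs_nbhs; split => //; exact: open_ereal_lt_ereal.
near (pinfty_nbhs R) => r.
have r1 : 1 < r by near: r; apply: nbhs_pinfty_gt; exact: num_real.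
(* Together with [1 < r], hence [r <= r ^+ 2], this makes the lower bound [r ^+ 2 * (M - L) / M] at
   least [A] without a square root. *)
have rA : A * M / (M - L) < r by near: r; apply: nbhs_pinfty_gt; exact: num_real.
have rL : (Mlim r < L%:E)%E by near: r; exact: (limr _ (lt_near _ ML)).
have r0 : 0 < r by lra.
near=> t.
have concL : (concentration rho r t <= L%:E)%E.
  by apply: ltW; near: t; exact: (limt r r0 _ (lt_near _ rL)).
apply: le_trans (dispersion_ge M0 reg (ltW r0) concL).
have ML0 : 0 < M - L by lra.
rewrite mulrC ler_pdivlMr // -ler_pdivrMr //.
apply: le_trans (ltW rA) _.
by rewrite expr2 ler_peMr // ltW.
Unshelve. all: by end_near. Qed.

Lemma cvgy_ereal_sup (R : realType) (f : R -> R) :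
  f t @[t --> +oo] --> +oo ->
  ereal_sup [set (f t)%:E | t in [set t | 0 < t]] = +oo%E.
Proof.
move=> /cvgryPge fy; apply/eqyP => A _.
near (pinfty_nbhs R) => t.
have At : A <= f t by near: t; exact: fy.
have t0 : 0 < t by near: t; apply: nbhs_pinfty_gt; exact: num_real.
apply: (@le_trans _ _ (f t)%:E); first by rewrite lee_fin.
by apply: ereal_sup_ubound; exists t.
Unshelve. all: by end_near. Qed.

Theorem proposition1 (R : realType) (M : R) (rho : R -> R * R * R -> R) :
  0 < M ->
  regular_mass_distribution M rho ->
  (totally_dispersive rho \/ partially_dispersive M rho ->
     statistically_dispersive M rho) /\
  (totally_dispersive rho ->
     statistical_dispersion M rho t @[t --> +oo] --> +oo).
Proof.
move=> M0 reg.
have total : totally_dispersive rho ->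
    statistical_dispersion M rho t @[t --> +oo] --> +oo.
  move=> /(limit_concentration_dispersion M0 reg); apply.
  by rewrite lexx lte_fin.
split=> // -[/total|[Minf /andP[Minf0 MinfM] lim]]; first exact: cvgy_ereal_sup.
apply/cvgy_ereal_sup/(limit_concentration_dispersion M0 reg lim).
by rewrite (ltW Minf0).
Qed.
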